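(* Let $E$ be an $n$-dimensional vector space over a field $\mathbb{F}$, and let $(E,\mathcal{I})$ be a $q$-matroid given by its collection of independent spaces, i.e. $\mathcal{I}\subseteq\mathcal{L}(E)$ satisfies (I1), (I2), (I3) and (I4). Then $\mathcal{I}$ satisfies the axiom (nI3) For all $I,J\in\mathcal{I}$ satisfying $\dim I<\dim J$, there exists a codimension $1$ subspace $X\subseteq E$ with $I\subseteq X$, $J\not\subseteq X$ such that $I+x\in\mathcal{I}$ for all $1$-dimensional $x\subseteq E$, $x\not\subseteq X$.
   Context: $n$ is a positive integer, $\mathbb{F}$ is an arbitrary field, and $\mathcal{L}(E)$ denotes the lattice of all subspaces of $E$; for a subspace $A$, $\mathcal{L}(A)$ is the set of all subspaces of $A$. For a family $\mathcal{A}\subseteq\mathcal{L}(E)$, $\max(\mathcal{A})$ is the set of members of $\mathcal{A}$ that are maximal with respect to inclusion. Independence axioms for $\mathcal{I}\subseteq\mathcal{L}(E)$: (I1) $\mathcal{I}\neq\emptyset$. (I2) For all $I,J\in\mathcal{L}(E)$, if $J\in\mathcal{I}$ and $I\subseteq J$, then $I\in\mathcal{I}$. (I3) For all $I,J\in\mathcal{I}$ with $\dim I<\dim J$, there exists a $1$-dimensional subspace $x\subseteq J$, $x\not\subseteq I$, such that $I+x\in\mathcal{I}$. (I4) For all $A,B\in\mathcal{L}(E)$ and $I,J\in\mathcal{L}(E)$ such that $I\in\max(\mathcal{I}\cap\mathcal{L}(A))$ and $J\in\max(\mathcal{I}\cap\mathcal{L}(B))$, there exists $K\in\max(\mathcal{I}\cap\mathcal{L}(A+B))$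 such that $K\subseteq I+J$. *)

(* Defs.v *)
From mathcomp Require Import all_boot all_order all_algebra.
From mathcomp Require Import classical_sets.

Set Implicit Arguments.
Unset Strict Implicit.
Unset Printing Implicit Defensive.

Local Open Scope ring_scope.
Local Open Scope classical_set_scope.

(* {vspace E} is the lattice L(E) of subspaces of E. A family of subspaces is
   an arbitrary subset of it: the field may be infinite and membership need
   not be decidable. *)

Definition subspaces (F : fieldType) (E : vectType F) (A : {vspace E}) :
    set {vspace E} :=
  [set U | (U <= A)%VS].

Definition max_members (F : fieldType) (E : vectType F)
    (S : set {vspace E}) : set {vspace E} :=
  [set U | S U /\ forall V : {vspace E}, S V -> (U <= V)%VS -> V = U].

Definition axiom_I1 (F : fieldType) (E : vectType F)
    (Ind : set {vspace E}) : Prop :=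
  Ind !=set0.

Definition axiom_I2 (F : fieldType) (E : vectType F)
    (Ind : set {vspace E}) : Prop :=
  forall I J : {vspace E}, Ind J -> (I <= J)%VS -> Ind I.

Definition axiom_I3 (F : fieldType) (E : vectType F)
    (Ind : set {vspace E}) : Prop :=
  forall I J : {vspace E}, Ind I -> Ind J -> (\dim I < \dim J)%N ->
    exists x : {vspace E},
      [/\ \dim x = 1%N, (x <= J)%VS, ~~ (x <= I)%VS & Ind (I + x)%VS].

Definition axiom_I4 (F : fieldType) (E : vectType F)
    (Ind : set {vspace E}) : Prop :=
  forall A B I J : {vspace E},
    max_members (Ind `&` subspaces A) I ->
    max_members (Ind `&` subspaces B) J ->
    exists K : {vspace E},
      max_members (Ind `&` subspaces (A + B)%VS) K /\ (K <= I + J)%VS.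

Record qmatroid_independent (F : fieldType) (E : vectType F)
    (Ind : set {vspace E}) : Prop := QMatroidIndependent {
  qmatroid_I1 : axiom_I1 Ind;
  qmatroid_I2 : axiom_I2 Ind;
  qmatroid_I3 : axiom_I3 Ind;
  qmatroid_I4 : axiom_I4 Ind
}.

(* Codimension 1 is stated additively to avoid truncated subtraction. *)
Definition axiom_nI3 (F : fieldType) (E : vectType F)
    (Ind : set {vspace E}) : Prop :=
  forall I J : {vspace E}, Ind I -> Ind J -> (\dim I < \dim J)%N ->
    exists X : {vspace E},
      [/\ (\dim X).+1 = \dim {:E}, (I <= X)%VS, ~~ (J <= X)%VS &
          forall x : {vspace E}, \dim x = 1%N -> ~~ (x <= X)%VS ->
            Ind (I + x)%VS].

(* Main.v *)
Require Import Defs.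
From mathcomp Require Import all_boot all_order all_algebra.
From mathcomp Require Import boolp classical_sets.

(** The axiom (nI3) holds because an independent space has a closure. Given an
    independent [I], let [Z] be maximal among the spaces in which [I] is a
    maximal independent space. If [x] is a line such that [I + x] is dependent,
    then [I] is also maximal independent in [I + x], so (I4), applied to [Z] and
    [I + x] with the same space [I] on both sides, makes [I] maximal independent
    in [Z + x]; as [Z] cannot grow, [x] lies in [Z]. Thus [Z] contains every
    line that cannot be added to [I] ([maximal_spanned_closure]). By (I3), an
    independent space [J] of larger dimension than [I] is not inside [Z]
    ([independent_not_in_spanned]). Every hyperplane that contains [Z] but not
    [J] ([hyperplane_separation]) is then as required, because a line outside
    the hyperplane is outside [Z]. *)

Set Implicit Arguments.
Unset Strict Implicit.
Unset Printing Implicit Defensive.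

Import GRing.Theory.

Local Open Scope ring_scope.
Local Open Scope classical_set_scope.

(** Chains of subspaces have bounded length, so climbing inside an arbitrary
    family stops at a maximal member. *)
Lemma max_members_above (F : fieldType) (E : vectType F)
    (S : set {vspace E}) (U : {vspace E}) :
  S U -> exists2 V, max_members S V & (U <= V)%VS.
Proof.
have [m] := ubnP (\dim {:E} - \dim U)%N.
elim: m U => // m IHm U lt_codim SU.
have [maxU|] := pselect (forall V : {vspace E}, S V -> (U <= V)%VS -> V = U).
  by exists U; [split | exact: subvv].
move=> /existsNP[V /not_implyP[SV /not_implyP[sUV /eqP neVU]]].
have ltUV : (\dim U < \dim V)%N.
  by rewrite ltn_neqAle dimvS // andbT (dimv_leqif_eq sUV) eq_sym.
have leVE : (\dim V <= \dim {:E})%N by rewrite dimvS ?subvf.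
have [|W maxW sVW] := IHm V _ SV; last first.
  by exists W => //; exact: subv_trans sVW.
rewrite -ltnS; apply: leq_trans lt_codim; rewrite ltnS.
by rewrite ltn_sub2l // (leq_trans ltUV).
Qed.

Lemma dim_add_vline (F : fieldType) (E : vectType F) (U : {vspace E}) (v : E) :
  v \notin U -> \dim (U + <[v]>) = (\dim U).+1.
Proof.
move=> vnU; have v_neq0 : v != 0 by apply: contraNneq vnU => ->; exact: mem0v.
rewrite dimv_disjoint_sum ?dim_vline ?v_neq0 ?addn1 //.
apply/eqP; rewrite -subv0; apply/subvP => w; rewrite memv_cap.
case/andP=> wU /vlineP[a def_w]; move: wU.
by rewrite def_w rpredZeq (negPf vnU) orbF memv0 scaler_eq0 => ->.
Qed.

(** If the vector [v] is in [J] but not in [Z], then [Z] and a complement of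
    [Z + <[v]>] together span a hyperplane that misses [v]. *)
Lemma hyperplane_separation (F : fieldType) (E : vectType F)
    (Z J : {vspace E}) :
  ~~ (J <= Z)%VS ->
  exists X : {vspace E},
    [/\ (\dim X).+1 = \dim {:E}, (Z <= X)%VS & ~~ (J <= X)%VS].
Proof.
move=> /subvPn[v vJ vnZ].
pose X := (Z + (Z + <[v]>)^C)%VS.
have fullX : (X + <[v]> = fullv)%VS.
  by rewrite /X -addvA [(_^C + _)%VS]addvC addvA addv_complf.
have dimX : (\dim X < \dim {:E})%N.
  have leZv : ((\dim Z).+1 <= \dim {:E})%N.
    by rewrite -(dim_add_vline vnZ) dimvS ?subvf.
  apply: leq_ltn_trans (dimv_add_leqif _ _) _.
  by rewrite dimv_compl (dim_add_vline vnZ) -addSn subnKC.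
have vnX : v \notin X.
  apply: contraTN dimX => vX; rewrite -leqNgt -fullX dimvS //.
  by rewrite subv_add subvv -memvE.
exists X; split; [by rewrite -(dim_add_vline vnX) fullX | exact: addvSl |].
by apply: contra vnX => /subvP; apply.
Qed.

(** Between [I] and [I + x] there is no other space, for [x] a line. *)
Lemma max_independent_add_line (F : fieldType) (E : vectType F)
    (Ind : set {vspace E}) (I x : {vspace E}) :
  Ind I -> \dim x = 1%N -> ~ Ind (I + x)%VS ->
  max_members (Ind `&` subspaces (I + x)%VS) I.
Proof.
move=> IndI dimx depIx; split=> [|V [IndV sVIx] sIV].
  by split=> //; exact: addvSl.
have neVIx : V != (I + x)%VS by apply: contra_notN depIx => /eqP <-.
apply/eqP; rewrite eq_sym -(dimv_leqif_eq sIV) eqn_leq dimvS //= -ltnS.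
apply: (@leq_trans (\dim (I + x)%VS)).
  by rewrite ltn_neqAle (dimv_leqif_eq sVIx) neVIx dimvS.
by rewrite -addn1 -dimx; exact: dimv_add_leqif.
Qed.

(** The case of (I4) in which both maximal spaces are [I]: the spaces in which
    [I] is maximal independent are closed under sum. *)
Lemma max_independent_add (F : fieldType) (E : vectType F)
    (Ind : set {vspace E}) (A B I : {vspace E}) :
  axiom_I4 Ind ->
  max_members (Ind `&` subspaces A) I ->
  max_members (Ind `&` subspaces B) I ->
  max_members (Ind `&` subspaces (A + B)%VS) I.
Proof.
move=> I4 maxA maxB; have [K [maxK]] := I4 _ _ _ _ maxA maxB.
rewrite addvv => sKI; have [[IndI sIA] _] := maxA.
suff -> : I = K by [].
by apply: maxK.2 => //; split=> //; exact: subv_trans (addvSl _ _).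
Qed.

(** The closure is built from above, as a maximal member of the family of spaces
    in which [I] is maximal independent: that family contains [I], and it is
    stable under sum, so a maximal member absorbs every [I + x] of the
    family. *)
Lemma maximal_spanned_closure (F : fieldType) (E : vectType F)
    (Ind : set {vspace E}) (I : {vspace E}) :
  axiom_I4 Ind -> Ind I ->
  exists Z : {vspace E}, max_members (Ind `&` subspaces Z) I /\
    forall x : {vspace E}, \dim x = 1%N -> ~ Ind (I + x)%VS -> (x <= Z)%VS.
Proof.
move=> I4 IndI.
have max_self : [set Z | max_members (Ind `&` subspaces Z) I] I.
  split=> [|V [_ sVI] sIV]; first by split=> //; exact: subvv.
  by apply/eqP; rewrite eqEsubv sVI.
have [Z [maxI maxZ] _] := max_members_above max_self.
exists Z; split=> // x dimx depIx.
have maxIx := max_independent_add_line IndI dimx depIx.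
have <- : (Z + (I + x))%VS = Z.
  by apply: maxZ (addvSl _ _); exact: max_independent_add.
by rewrite addvA addvSr.
Qed.

(** Otherwise (I3) would enlarge [I] by a line of [J], inside [Z]. *)
Lemma independent_not_in_spanned (F : fieldType) (E : vectType F)
    (Ind : set {vspace E}) (I J Z : {vspace E}) :
  axiom_I3 Ind -> max_members (Ind `&` subspaces Z) I ->
  Ind J -> (\dim I < \dim J)%N -> ~~ (J <= Z)%VS.
Proof.
move=> I3 [[IndI sIZ] maxI] IndJ ltIJ; apply/negP => sJZ.
have [x [_ sxJ /negP nsxI IndIx]] := I3 _ _ IndI IndJ ltIJ.
apply: nsxI; rewrite -(maxI (I + x)%VS) ?addvSr ?addvSl //.
by split=> //; rewrite /subspaces /= subv_add sIZ (subv_trans sxJ).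
Qed.

Theorem theorem23 (n : nat) (n_gt0 : (0 < n)%N) (F : fieldType)
    (E : vectType F) (dimE : \dim {:E} = n) (Ind : set {vspace E})
    (qmInd : qmatroid_independent Ind) :
  axiom_nI3 Ind.
Proof.
case: qmInd => _ _ I3 I4 I J IndI IndJ ltIJ.
have [Z [maxI closedZ]] := maximal_spanned_closure I4 IndI.
have nsJZ := independent_not_in_spanned I3 maxI IndJ ltIJ.
have [X [dimX sZX nsJX]] := hyperplane_separation nsJZ.
exists X; split=> // [|x dimx nsxX]; first exact: subv_trans maxI.1.2 sZX.
apply: contrapT => depIx; case/negP: nsxX.
exact: subv_trans (closedZ x dimx depIx) sZX.
Qed.
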